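(* If every finitely presented group with exactly one end is locally tame, then every finitely presented group with infinitely many ends is locally tame.
   Context: Let $G=\langle X\mid R\rangle$ be a group given by a presentation, and let $K$ be the standard presentation $2$-complex of this presentation: $K$ has one vertex, one edge (a loop) for every generator $x\in X$, and one $2$-cell for every relator $r\in R$, so that $\pi_1(K)\cong G$. For a subgroup $H$ of $G$, denote by $Cayley_2(G,H)$ the covering space of $K$ corresponding to $H$ (for $H$ trivial this is the universal cover of $K$, the Cayley complex of $G$). Tame subgroup: a finitely generated subgroup $H$ of a finitely presented group $G$ is tame in $G$ if for any finite subcomplex $C$ of $Cayley_2(G,H)$ and for any component $C_0$ of $Cayley_2(G,H)-C$ the group $\pi_1(C_0)$ is finitely generated. Here $Cayley_2(G,H)$ is formed using a finite presentation of $G$; it is known (Mihalik) that tameness of a finitely generated subgroup $H$ does not depend on the choice of the finite presentation of $G$. Locally tame group: a group $G$ is locally tame if all finitely generated subgroups of $G$ are tame in $G$. The number of ends of a finitely generated group is the number of ends of its Cayley graph with respect to any finite generating set; it is always $0$, $1$, $2$, or infinite. *)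

(* Defs.v *)
From HB Require Import structures.
From mathcomp Require Import all_boot all_order all_algebra.
From mathcomp Require Import all_classical all_reals all_analysis.

Set Implicit Arguments.
Unset Strict Implicit.
Unset Printing Implicit Defensive.

Import Order.TTheory GRing.Theory Num.Theory.
Import numFieldNormedType.Exports.

Local Open Scope classical_set_scope.
Local Open Scope ring_scope.

Section Subgroups.
Context {G : groupType}.

Definition is_subgroup (H : set G) : Prop :=
  [/\ H 1%g, forall a b, H a -> H b -> H (a * b)%g & forall a, H a -> H a^-1%g].

Definition generated (s : seq G) : set G := smallest is_subgroup [set` s].

Definition fin_gen_subgroup (H : set G) : Prop := exists s, H = generated s.

Definition rcoset (H : set G) (g : G) : set G := [set (h * g)%g | h in H].

End Subgroups.

Definition finitely_generated (G : groupType) : Prop :=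
  fin_gen_subgroup [set: G].

Section Presentations.
Context {X : finType}.

(* The letter (x, true) stands for x, and (x, false) for its inverse. *)
Definition word : Type := seq (X * bool).

Inductive word_eq (rels : seq word) : word -> word -> Prop :=
| word_eq_refl w : word_eq rels w w
| word_eq_sym w1 w2 : word_eq rels w1 w2 -> word_eq rels w2 w1
| word_eq_trans w1 w2 w3 :
    word_eq rels w1 w2 -> word_eq rels w2 w3 -> word_eq rels w1 w3
| word_eq_cancel u v x b :
    word_eq rels (u ++ [:: (x, b); (x, ~~ b)] ++ v) (u ++ v)
| word_eq_relator u v r : r \in rels -> word_eq rels (u ++ r ++ v) (u ++ v).

Context {G : groupType}.
Variable gen : X -> G.

Definition letter_val (l : X * bool) : G :=
  if l.2 then gen l.1 else (gen l.1)^-1%g.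

Fixpoint word_val (w : word) : G :=
  if w is l :: w' then (letter_val l * word_val w')%g else 1%g.

Definition presents (rels : seq word) : Prop :=
  (forall g, exists w, word_val w = g) /\
  (forall w1 w2, word_val w1 = word_val w2 <-> word_eq rels w1 w2).

End Presentations.
Arguments word : clear implicits.

Definition finitely_presented (G : groupType) : Prop :=
  exists (X : finType) (rels : seq (word X)) (gen : X -> G), presents gen rels.

Section Ends.
Context {G : groupType}.

Definition cayley_adj (S : seq G) : rel G :=
  [rel g h | has (fun s => (h == g * s)%g || (g == h * s)%g) S].

(* The component of g in the Cayley graph of G with respect to S, with the
   vertices of K removed; it is empty if g belongs to K. *)
Definition graph_component (S K : seq G) (g : G) : set G :=
  [set h | exists p : seq G, [/\ path (cayley_adj S) g p, last g p = h
                               & all [predC K] (g :: p)]].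

Definition ends_at_least (S : seq G) (n : nat) : Prop :=
  exists (K : seq G) (f : 'I_n -> G),
    (forall i, infinite_set (graph_component S K (f i))) /\
    (forall i j, graph_component S K (f i) (f j) -> i = j).

End Ends.

Definition number_of_ends (G : groupType) (n : nat) : Prop :=
  finitely_generated G /\
  forall S : seq G, [set: G] = generated S ->
    ends_at_least S n /\ ~ ends_at_least S n.+1.

Definition infinitely_many_ends (G : groupType) : Prop :=
  finitely_generated G /\
  forall S : seq G, [set: G] = generated S -> forall n, ends_at_least S n.

Section FundamentalGroup.
Context {R : realType} {T : topologicalType}.
Variables (A : set T) (x : T).

Definition loop_in (f : R -> T) : Prop :=
  [/\ {within `[0, 1], continuous f}, f 0 = x, f 1 = x
    & forall t, t \in `[0, 1] -> A (f t)].

Definition loop_homotopic (f g : R -> T) : Prop :=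
  exists F : R * R -> T,
    [/\ {within `[0, 1] `*` `[0, 1], continuous F},
        (forall t, t \in `[0, 1] -> F (0, t) = f t /\ F (1, t) = g t),
        (forall s, s \in `[0, 1] -> F (s, 0) = x /\ F (s, 1) = x)
      & forall s t, s \in `[0, 1] -> t \in `[0, 1] -> A (F (s, t))].

Definition loop_cat (f g : R -> T) (t : R) : T :=
  if t <= 2^-1 then f (2 * t) else g (2 * t - 1).

Definition loop_rev (f : R -> T) (t : R) : T := f (1 - t).

(* The loops whose class lies in the subgroup of the fundamental group of A
   at x generated by the classes of the loops s i. *)
Inductive pi1_generated (n : nat) (s : 'I_n -> R -> T) : (R -> T) -> Prop :=
| pi1_gen i : pi1_generated s (s i)
| pi1_one : pi1_generated s (cst x)
| pi1_mul f g :
    pi1_generated s f -> pi1_generated s g -> pi1_generated s (loop_cat f g)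
| pi1_inv f : pi1_generated s f -> pi1_generated s (loop_rev f)
| pi1_homotopic f g :
    pi1_generated s f -> loop_homotopic f g -> pi1_generated s g.

Definition pi1_finitely_generated : Prop :=
  exists (n : nat) (s : 'I_n -> R -> T),
    (forall i, loop_in (s i)) /\ (forall f, loop_in f -> pi1_generated s f).

End FundamentalGroup.
Arguments pi1_finitely_generated R {T} A x.

Section Cayley2.
Context {R : realType} {G : groupType} {X : finType}.
Variables (rels : seq (word X)) (H : set G).

Definition vertex : Type := set_type (range (rcoset H)).

Lemma vertex_mul_subproof (v : vertex) (g : G) :
  [set (a * g)%g | a in val v] \in range (rcoset H).
Proof.
case: v => A /=; rewrite inE => -[k _ <-]; rewrite inE.
exists (k * g)%g => //; apply/seteqP; split.
  by move=> _ [h Hh <-]; exists (h * k)%g; [exists h | rewrite mulgA].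
by move=> _ [_ [h Hh <-] <-]; exists h => //; rewrite mulgA.
Qed.

Definition vertex_mul (v : vertex) (g : G) : vertex :=
  SigSub (vertex_mul_subproof v g).

Definition open_interval : Type := {t : R | 0 < t < 1}.
Definition open_disc : Type := {z : R * R | z.1 ^+ 2 + z.2 ^+ 2 < 1}.

(* The covering of the presentation complex corresponding to H is the disjoint
   union of its open cells: a vertex for each right coset of H, an edge from
   Hg to Hgx for each coset Hg and generator x, and a 2-cell for each coset Hg
   and relator r, attached along the path that starts at Hg and reads r. The
   parameter gen is used by the topology only. *)
Inductive cayley2_complex (gen : X -> G) : Type :=
| Vertex of vertex
| Edge of vertex & X & open_interval
| Face of vertex & seq_sub rels & open_disc.
Arguments Vertex {gen}.
Arguments Edge {gen}.
Arguments Face {gen}.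

Variable gen : X -> G.

Local Notation cayley2 := (cayley2_complex gen).

Definition edge_map (v : vertex) (x : X) (t : R) : cayley2 :=
  if insub t is Some u then Edge v x u
  else if t <= 0 then Vertex v else Vertex (vertex_mul v (gen x)).

Definition letter_path (v : vertex) (l : X * bool) (t : R) : cayley2 :=
  if l.2 then edge_map v l.1 t
  else edge_map (vertex_mul v (gen l.1)^-1%g) l.1 (1 - t).

(* The edge path reading w from v, parametrised by [0, size w]. *)
Fixpoint word_path (v : vertex) (w : word X) (t : R) : cayley2 :=
  if w is l :: w' then
    if t <= 1 then letter_path v l t
    else word_path (vertex_mul v (letter_val gen l)) w' (t - 1)
  else Vertex v.

(* The characteristic map of a 2-cell, precomposed with polar coordinates
   (radius p.1, angle 2 pi p.2), which map [0, 1]^2 onto the closed disc. *)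
Definition face_map (v : vertex) (r : seq_sub rels) (p : R * R) : cayley2 :=
  if insub (p.1 * cos (2 * pi * p.2), p.1 * sin (2 * pi * p.2)) is Some z
  then Face v r z
  else word_path v (val r) ((size (val r))%:R * p.2).

(* The weak topology with respect to the closed cells. Polar coordinates being
   a quotient map from [0, 1]^2 onto the closed disc, openness of preimages can
   be tested on [0, 1]^2. *)
Definition cayley2_open (U : set cayley2) : Prop :=
  (forall v x, open (edge_map v x @^-1` U : set (subspace `[0, 1]%classic))) /\
  (forall v r, open (face_map v r @^-1` U :
     set (subspace (`[0, 1]%classic `*` `[0, 1]%classic)))).

Lemma cayley2_openT : cayley2_open setT.
Proof. by split=> *; rewrite preimage_setT; exact: openT. Qed.

Lemma cayley2_openI : setI_closed cayley2_open.
Proof.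
move=> U V [U1 U2] [V1 V2]; split=> [v x|v r]; rewrite preimage_setI.
  by apply: openI; [exact: U1 | exact: V1].
by apply: openI; [exact: U2 | exact: V2].
Qed.

Lemma cayley2_open_bigU (I : Type) (f : I -> set cayley2) :
  (forall i, cayley2_open (f i)) -> cayley2_open (\bigcup_i f i).
Proof.
move=> of_; split=> [v x|v r]; rewrite preimage_bigcup; apply: bigcup_open => i _.
  exact: (of_ i).1.
exact: (of_ i).2.
Qed.

HB.instance Definition _ := gen_eqMixin cayley2.
HB.instance Definition _ := gen_choiceMixin cayley2.
HB.instance Definition _ := isOpenTopological.Build cayley2
  cayley2_openT cayley2_openI cayley2_open_bigU.

Inductive cell : Type :=
| Cell0 of vertex
| Cell1 of vertex & X
| Cell2 of vertex & seq_sub rels.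

Definition open_cell (c : cell) : set cayley2 :=
  match c with
  | Cell0 v => [set Vertex v]
  | Cell1 v x => range (Edge v x)
  | Cell2 v r => range (Face v r)
  end.

Definition finite_subcomplex (C : set cayley2) : Prop :=
  closed C /\
  exists2 D : set cell, finite_set D & C = \bigcup_(c in D) open_cell c.

Definition tame_in_presentation : Prop :=
  forall C : set cayley2, finite_subcomplex C ->
  forall x : cayley2, ~ C x ->
    pi1_finitely_generated R (connected_component (~` C) x) x.

End Cayley2.
Arguments tame_in_presentation R {G X} rels H gen.

(* Tameness does not depend on the choice of the finite presentation. *)
Definition tame (R : realType) (G : groupType) (H : set G) : Prop :=
  forall (X : finType) (rels : seq (word X)) (gen : X -> G),
    presents gen rels -> tame_in_presentation R rels H gen.

Definition locally_tame (R : realType) (G : groupType) : Prop :=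
  forall H : set G, fin_gen_subgroup H -> tame R H.

(* Main.v *)
Require Import Defs.
From HB Require Import structures.
From mathcomp Require Import all_boot all_order all_algebra.
From mathcomp Require Import all_classical all_reals all_analysis.
From mathcomp Require Import zify ring lra.

Set Implicit Arguments.
Unset Strict Implicit.
Unset Printing Implicit Defensive.

Import Order.TTheory GRing.Theory Num.Theory.
Import numFieldNormedType.Exports.

Local Open Scope classical_set_scope.
Local Open Scope ring_scope.

(** A group with infinitely many ends can be traded for a one-ended one by
    multiplying it with the integers, and tameness passes back to the factor.

    Let G be finitely presented and infinite, and let H be a finitely generated
    subgroup of G. The group G x Z is finitely presented: add to a presentation
    of G a generator t and a relator [x, t] for every generator x
    ([prod_presents]). It has one end, because both factors are infinite and
    finitely generated ([product_one_end]). The subgroup H x Z is finitely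
    generated ([fin_gen_cylinder]), so by hypothesis it is tame in G x Z.

    The cosets of H x Z in G x Z correspond to those of H in G. Hence the complex
    of H x Z is the complex K of H with a loop t added at every vertex and a
    2-cell [x, t] added along every edge x; it is the 2-skeleton of the product of
    K with a circle. It retracts onto K: the projection collapses the loops t to
    their vertices and every 2-cell [x, t] onto the edge x ([proj],
    [base_section]). The projection maps open cells into open cells with finite
    fibres on cells, so the preimage of a finite subcomplex C of K is a finite
    subcomplex ([finite_subcomplex_proj]). Then a component of the complement of C
    is a retract of a component of the complement of the preimage, and its
    fundamental group, a quotient of a finitely generated group, is finitely
    generated ([tame_from_product]). *)

(** * Finitely generated subgroups of direct products *)

(** The integers as a multiplicative group; [int] itself only carries an
    additive structure. *)
Definition int_grp : Type := int.

HB.instance Definition _ := Choice.on int_grp.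

HB.instance Definition _ := isGroup.Build int_grp
  (@addrA int) (@add0r int) (@addr0 int) (@addNr int) (@addrN int).

Lemma mulg_int (m n : int_grp) : (m * n)%g = (m : int) + (n : int).
Proof. by []. Qed.

Lemma invg_int (m : int_grp) : (m^-1)%g = - (m : int).
Proof. by []. Qed.

Section GeneratedSubgroups.
Context {G : groupType}.
Implicit Types (s : seq G) (H : set G).

Lemma generated_subgroup s : is_subgroup (generated s).
Proof.
split.
- by move=> H [[]].
- by move=> a b sa sb H gH; case: (gH) => -[_ HM _] _; apply: HM (sa H gH) (sb H gH).
- by move=> a sa H gH; case: (gH) => -[_ _ HV] _; apply: HV (sa H gH).
Qed.

Lemma generated_mem s a : a \in s -> generated s a.
Proof. by move=> sa H [_]; apply. Qed.

Lemma generated_min s H :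
  is_subgroup H -> (forall a, a \in s -> H a) -> generated s `<=` H.
Proof. by move=> gH sH a; apply; split. Qed.

End GeneratedSubgroups.

Lemma generated_morph (G L : groupType) (f : G -> L) s a :
  {morph f : x y / (x * y)%g} -> generated s a -> generated (map f s) (f a).
Proof.
move=> fM; have [H1 HM HV] := generated_subgroup (map f s).
have f1 : f 1%g = 1%g by apply: (mulgI (f 1%g)); rewrite -fM !mulg1.
apply: (generated_min (H := f @^-1` generated (map f s))) => [|b bs] /=.
  split=> /= [|b c sb sc|b sb]; first by rewrite f1.
    by rewrite fM; apply: HM.
  have -> : f b^-1%g = (f b)^-1%g.
    by apply/esym/mulg1_eq; rewrite -fM mulgV.
  exact: HV.
by apply: generated_mem; rewrite map_f.
Qed.

Section ProductSubgroup.
Context {G L : groupType}.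

Definition cylinder (H : set G) : set (G * L)%type := fst @^-1` H.

Lemma cylinder_subgroup (H : set G) : is_subgroup H -> is_subgroup (cylinder H).
Proof.
case=> H1 HM HV; split=> //=.
- by move=> [a m] [b n]; apply: HM.
- by move=> [a m]; apply: HV.
Qed.

Definition in_left (g : G) : G * L := (g, 1%g).

Definition in_right (l : L) : G * L := (1%g, l).

Lemma in_leftM : {morph in_left : x y / (x * y)%g}.
Proof. by move=> x y; congr pair; rewrite /= mulg1. Qed.

Lemma in_rightM : {morph in_right : x y / (x * y)%g}.
Proof. by move=> x y; congr pair; rewrite /= mulg1. Qed.

Lemma in_left_right g l : (in_left g * in_right l)%g = (g, l).
Proof. by congr pair; rewrite /= (mulg1, mul1g). Qed.

Lemma fin_gen_cylinder (H : set G) :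
  finitely_generated L -> fin_gen_subgroup H -> fin_gen_subgroup (cylinder H).
Proof.
case=> sL genL [s ->].
pose S := map in_left s ++ map in_right sL; exists S.
have [S1 SM SV] := generated_subgroup S.
apply/seteqP; split; last first.
  apply: generated_min; first exact/cylinder_subgroup/generated_subgroup.
  move=> a; rewrite mem_cat => /orP[/mapP[b sb ->]|/mapP[l _ ->]].
    exact: generated_mem.
  by case: (generated_subgroup s).
have sub (S' : seq (G * L)) : {subset S' <= S} -> generated S' `<=` generated S.
  move=> S'S; apply: generated_min => [|a /S'S]; first exact: generated_subgroup.
  exact: generated_mem.
move=> [g l] sg; rewrite -in_left_right; apply: SM.
  apply: (sub (map in_left s)) => [a aS|]; first by rewrite mem_cat aS.
  exact: generated_morph in_leftM sg.
apply: (sub (map in_right sL)) => [a aS|]; first by rewrite mem_cat aS orbT.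
by apply: (generated_morph in_rightM); rewrite -genL.
Qed.

End ProductSubgroup.

Lemma int_grp_fin_gen : finitely_generated int_grp.
Proof.
exists [:: 1 : int]; apply/esym/seteqP; split=> // n _.
have [S1 SM SV] := generated_subgroup ([:: 1 : int] : seq int_grp).
have nat_gen (k : nat) : generated ([:: 1 : int] : seq int_grp) (k : int).
  elim: k => [|k IH]; first exact: S1.
  by apply: (SM (1 : int) (k : int)) => //; apply: generated_mem; rewrite inE.
by case: n => n; [exact: nat_gen | exact: (SV (n.+1 : int) (nat_gen _))].
Qed.

Lemma int_grp_infinite : infinite_set [set: int_grp].
Proof.
move=> fin; apply: infinite_nat; have := finite_image absz fin.
by apply: sub_finite_set => n _; exists (n : int).
Qed.

(** * A presentation of G x Z *)

Section Words.
Context {X : finType} {rels : seq (word X)}.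
Implicit Types u v w : word X.
Local Notation "u =w v" := (word_eq rels u v) (at level 70).

Lemma word_eq_cat u v w1 w2 : w1 =w w2 -> u ++ w1 ++ v =w u ++ w2 ++ v.
Proof.
elim=> {w1 w2} [w|w1 w2 _ IH|w1 w2 w3 _ IH1 _ IH2|a b x c|a b r rr].
- exact: word_eq_refl.
- exact: word_eq_sym.
- exact: word_eq_trans IH1 IH2.
- have := word_eq_cancel rels (u ++ a) (b ++ v) x c.
  by rewrite -!catA.
- have := word_eq_relator (u ++ a) (b ++ v) rr.
  by rewrite -!catA.
Qed.

Lemma word_eq_catl u w1 w2 : w1 =w w2 -> u ++ w1 =w u ++ w2.
Proof. by move=> /(word_eq_cat u [::]); rewrite !cats0. Qed.

Lemma word_eq_catr v w1 w2 : w1 =w w2 -> w1 ++ v =w w2 ++ v.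
Proof. exact: (word_eq_cat [::] v). Qed.

Definition inv_letter (l : X * bool) := (l.1, ~~ l.2).

(** From l m = m l: l^-1 m = l^-1 m l l^-1 = l^-1 l m l^-1 = m l^-1. *)
Lemma word_eq_commV (l m : X * bool) :
  [:: l; m] =w [:: m; l] -> [:: inv_letter l; m] =w [:: m; inv_letter l].
Proof.
case: l m => x b m lm; rewrite /inv_letter /=.
apply: (@word_eq_trans _ _ _ [:: (x, ~~ b); m; (x, b); (x, ~~ b)]).
  apply: word_eq_sym.
  exact: (word_eq_cancel rels [:: (x, ~~ b); m] [::] x b).
apply: (@word_eq_trans _ _ _ [:: (x, ~~ b); (x, b); m; (x, ~~ b)]).
  exact: (word_eq_cat [:: (x, ~~ b)] [:: (x, ~~ b)] (word_eq_sym lm)).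
by have := word_eq_cancel rels [::] [:: m; (x, ~~ b)] x (~~ b); rewrite negbK.
Qed.

Lemma word_eq_commutator (x y : X) :
  [:: (x, true); (y, true); (x, false); (y, false)] =w [::] ->
  forall b c, [:: (x, b); (y, c)] =w [:: (y, c); (x, b)].
Proof.
move=> xy1.
have xy : [:: (x, true); (y, true)] =w [:: (y, true); (x, true)].
  apply: word_eq_sym.
  apply: word_eq_trans (word_eq_catr [:: (y, true); (x, true)]
    (word_eq_sym xy1)) _ => /=.
  apply: word_eq_trans (word_eq_cancel rels
    [:: (x, true); (y, true); (x, false)] [:: (x, true)] y false) _ => /=.
  exact: (word_eq_cancel rels [:: (x, true); (y, true)] [::] x false).
have xVy : [:: (x, false); (y, true)] =w [:: (y, true); (x, false)].
  exact: (word_eq_commV xy).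
move=> [] []; [exact: xy | | exact: xVy |]; apply: word_eq_sym.
  exact: (word_eq_commV (word_eq_sym xy)).
exact: (word_eq_commV (word_eq_sym xVy)).
Qed.

Context {G : groupType}.
Variable gen : X -> G.

Lemma word_val_cat u v :
  word_val gen (u ++ v) = (word_val gen u * word_val gen v)%g.
Proof. by elim: u => /= [|l u ->]; rewrite ?mul1g ?mulgA. Qed.

Lemma word_eq_val w1 w2 :
  (forall r, r \in rels -> word_val gen r = 1%g) ->
  w1 =w w2 -> word_val gen w1 = word_val gen w2.
Proof.
move=> rels1; elim=> {w1 w2} // [w1 w2 w3 _ -> _ -> //|u v x b|u v r /rels1 r1].
  rewrite !word_val_cat; congr (_ * _)%g.
  by case: b; rewrite /= /letter_val /= ?mulgA mulg1 ?mulgV ?mulVg mul1g.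
by rewrite !word_val_cat r1 mul1g.
Qed.

Lemma presents_rel_val r : presents gen rels -> r \in rels -> word_val gen r = 1%g.
Proof.
move=> [_ pres] rr; have := word_eq_relator [::] [::] rr.
by rewrite cats0 => /pres.
Qed.

End Words.

Section ProductPresentation.
Context {X : finType} {G : groupType}.
Variables (rels : seq (word X)) (gen : X -> G).

Definition lift_letter (l : X * bool) : option X * bool := (Some l.1, l.2).

Definition lift_word (w : word X) : word (option X) := map lift_letter w.

Definition commutator (x : X) : word (option X) :=
  [:: (Some x, true); (None, true); (Some x, false); (None, false)].

Definition prod_rels : seq (word (option X)) :=
  map lift_word rels ++ map commutator (enum X).

Definition prod_gen (o : option X) : G * int_grp :=
  if o is Some x then (gen x, 1%g) else (1%g, 1 : int).

Local Notation "u =w v" := (word_eq prod_rels u v) (at level 70).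

Lemma letter_val_lift (l : X * bool) :
  letter_val prod_gen (lift_letter l) = (letter_val gen l, 1%g).
Proof. by case: l => x []; rewrite /letter_val //=; congr pair; rewrite invg1. Qed.

Lemma word_val_lift w :
  word_val prod_gen (lift_word w) = (word_val gen w, 1%g).
Proof.
elim: w => //= l w ->; rewrite letter_val_lift.
by congr pair; rewrite mulg1.
Qed.

Lemma word_eq_lift w1 w2 :
  word_eq rels w1 w2 -> lift_word w1 =w lift_word w2.
Proof.
elim=> {w1 w2} [w|w1 w2 _ IH|w1 w2 w3 _ IH1 _ IH2|u v x b|u v r rr].
- exact: word_eq_refl.
- exact: word_eq_sym.
- exact: word_eq_trans IH1 IH2.
- by rewrite /lift_word !map_cat; apply: word_eq_cancel.
- rewrite /lift_word !map_cat; apply: word_eq_relator.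
  by rewrite mem_cat map_f.
Qed.

Definition central_pow (n : int) : word (option X) := nseq (absz n) (None, 0 <= n).

Lemma central_pow_val (n : int) :
  word_val prod_gen (central_pow n) = (1%g, n).
Proof.
have pow (k : nat) b : word_val prod_gen (nseq k (None, b)) =
    (1%g, if b then (k : int) else - (k : int)).
  elim: k => [|k /= ->]; first by case: b.
  case: b; rewrite /letter_val /=; congr pair; rewrite /= ?invg1 ?mulg1 //.
  by rewrite mulg_int invg_int; lia.
by rewrite pow; congr pair; case: ifP => n0; lia.
Qed.

Lemma central_pow_cons b (n : int) :
  (None, b) :: central_pow n =w central_pow (n + if b then 1 else -1).
Proof.
have [bn|] := boolP (b == (0 <= n)).
  suff -> : (None, b) :: central_pow n =
    central_pow (n + if b then 1 else -1) by apply: word_eq_refl.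
  rewrite /central_pow (eqP bn); case: ifP => n0.
    have -> : absz (n + 1) = (absz n).+1 by lia.
    by have -> : 0 <= n + 1 by lia.
  have -> : absz (n - 1) = (absz n).+1 by lia.
  by have -> : (0 <= n - 1) = false by lia.
rewrite /central_pow; have [->|n0] := eqVneq n 0.
  by case: b => // _; apply: word_eq_refl.
move=> bn; have nb : (0 <= n) = ~~ b by case: (b) bn; case: (0 <= n).
have -> : absz n = (absz (n + if b then 1 else -1)).+1.
  by case: (b) nb => nb; lia.
rewrite /= nb.
apply: word_eq_trans (word_eq_cancel _ [::] _ None b) _ => /=.
have [m0|m0] := eqVneq (n + if b then 1 else -1) 0.
  by rewrite m0; apply: word_eq_refl.
suff -> : (0 <= n + if b then 1 else -1) = ~~ b by apply: word_eq_refl.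
by case: (b) nb m0 => nb m0; lia.
Qed.

(** The relators [x, t] make t commute with every letter of X, so it can be moved
    past a lifted word. *)
Lemma central_lift b w :
  (None, b) :: lift_word w =w lift_word w ++ [:: (None, b)].
Proof.
elim: w => [|[x c] w IH]; first exact: word_eq_refl.
have comm : [:: (Some x, true); (None, true); (Some x, false); (None, false)]
    =w [::].
  apply: (@word_eq_relator _ _ [::] [::] (commutator x)).
  by rewrite mem_cat (map_f commutator) ?orbT ?mem_enum.
apply: word_eq_trans (word_eq_catl [:: (Some x, c)] IH).
exact: (word_eq_catr (lift_word w)
  (word_eq_sym (word_eq_commutator comm c b))).
Qed.

(** Pushing every t to the right and cancelling leaves a word in X followed by a
    power of t. Two words with equal values then have the same exponent and
    X-parts with equal values in G, which reduces completeness of the new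
    relators to that of the old ones. *)
Lemma prod_normal_form (w : word (option X)) :
  exists u n, w =w lift_word u ++ central_pow n.
Proof.
elim: w => [|[[x|] b] w [u [n IH]]].
- by exists [::], 0; apply: word_eq_refl.
- by exists ((x, b) :: u), n; apply: (word_eq_catl [:: (Some x, b)]).
- exists u, (n + if b then 1 else -1).
  apply: word_eq_trans (word_eq_catl [:: (None, b)] IH) _.
  apply: word_eq_trans (word_eq_catr _ (central_lift b u)) _.
  by rewrite -catA; apply: word_eq_catl; apply: central_pow_cons.
Qed.

Lemma normal_form_val u n :
  word_val prod_gen (lift_word u ++ central_pow n) = (word_val gen u, n).
Proof.
rewrite word_val_cat word_val_lift central_pow_val.
by congr pair; rewrite ?mulg1 // mulg_int add0r.
Qed.

Lemma prod_presents : presents gen rels -> presents prod_gen prod_rels.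
Proof.
move=> pres; have [surj pres_eq] := pres.
have rels1 r : r \in prod_rels -> word_val prod_gen r = 1%g.
  rewrite mem_cat => /orP[/mapP[w rw ->]|/mapP[x _ ->]].
    by rewrite word_val_lift (presents_rel_val pres rw).
  rewrite /= /letter_val /=; congr pair.
  by rewrite /= !(invg1, mulg1, mul1g) mulgV.
split.
  move=> [g n]; have [w <-] := surj g.
  by exists (lift_word w ++ central_pow n); apply: normal_form_val.
move=> w1 w2; split; last exact: word_eq_val.
have [u1 [n1 w1E]] := prod_normal_form w1.
have [u2 [n2 w2E]] := prod_normal_form w2.
rewrite (word_eq_val rels1 w1E) (word_eq_val rels1 w2E) !normal_form_val.
move=> [/pres_eq u12 n12].
apply: word_eq_trans w1E _; apply: word_eq_trans _ (word_eq_sym w2E).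
by rewrite n12; apply: word_eq_catr; apply: word_eq_lift.
Qed.

End ProductPresentation.

(** * A product of two infinite finitely generated groups has one end *)

Section CayleyComponents.
Context {G : groupType}.
Implicit Types (S K B : seq G) (g h a b : G).

Lemma graph_component_refl S K g : g \notin K -> graph_component S K g g.
Proof. by move=> gK; exists [::]; split=> //=; rewrite gK. Qed.

Lemma graph_component_trans S K g h k :
  graph_component S K g h -> graph_component S K h k -> graph_component S K g k.
Proof.
move=> [p [gp ph pK]] [q [hq qk qK]]; exists (p ++ q); split.
- by rewrite cat_path gp ph.
- by rewrite last_cat ph.
- by move: pK qK; rewrite /= all_cat => /andP[-> ->] /andP[].
Qed.

Lemma graph_component_edge S K g h : cayley_adj S g h ->
  g \notin K -> h \notin K -> graph_component S K g h.
Proof.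
by move=> gh gK hK; exists [:: h]; split; rewrite //= ?gh ?gK ?hK.
Qed.

Lemma cayley_adj_sym S : symmetric (cayley_adj S).
Proof. by move=> g h; apply: eq_has => s; rewrite orbC. Qed.

Lemma graph_component_sym S K g h :
  graph_component S K g h -> graph_component S K h g.
Proof.
case=> p; elim: p g => [|k p IH] g [] /=.
  by move=> _ <- /andP[gK _]; apply: graph_component_refl.
move=> /andP[gk kp] ph /and3P[gK kK pK].
apply: (@graph_component_trans _ _ _ k); first by apply: IH; split=> //=; rewrite kK.
by apply: graph_component_edge; rewrite // cayley_adj_sym.
Qed.

(** Every a is joined to 1 by a path in the Cayley graph, and translating it by g
    gives a path from g to g a inside g B, where B is the finite set of its
    vertices. Taking for B the vertices of paths to the elements of the finite
    set T, one can move along the subgroup generated by T, one element of T at a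
    time, as long as the whole walk stays at points g for which g B misses K. *)
Lemma generated_connected S (T : seq G) : [set: G] = generated S ->
  exists B, forall K (U : set G),
    (forall g b, U g -> b \in B -> (g * b)%g \notin K) ->
    (forall g a, U g -> generated T a -> U (g * a)%g) ->
  forall g a, U g -> generated T a -> graph_component S K g (g * a)%g.
Proof.
move=> genS.
have near a : exists B, forall K g,
    (forall b, b \in B -> (g * b)%g \notin K) -> graph_component S K g (g * a)%g.
  have : generated S a by rewrite -genS.
  move: a; apply: (generated_min (H := [set a | exists B, _])).
    split=> /=.
    - exists [:: 1%g] => K g gK; rewrite mulg1.
      by apply: graph_component_refl; rewrite -[g]mulg1 gK ?inE.
    - move=> a b [A Aa] [B Bb]; exists (A ++ [seq (a * c)%g | c <- B]) => K g gK.
      rewrite mulgA; apply: (@graph_component_trans _ _ _ (g * a)%g).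
        by apply: Aa => c cA; apply: gK; rewrite mem_cat cA.
      apply: Bb => c cB; rewrite -mulgA; apply: gK.
      by rewrite mem_cat map_f ?orbT.
    - move=> a [A Aa]; exists [seq (a^-1 * c)%g | c <- A] => K g gK.
      apply: graph_component_sym; rewrite -{2}[g](mulgVK a).
      by apply: Aa => c cA; rewrite -mulgA; apply: gK; rewrite map_f.
  move=> s sS; exists [:: 1%g; s] => K g gK; apply: graph_component_edge.
  - by apply/hasP; exists s => //; rewrite eqxx.
  - by rewrite -[g]mulg1 gK ?inE ?eqxx.
  - by rewrite gK ?inE ?eqxx ?orbT.
have [B nearB] : exists B, forall K g,
    (forall b, b \in B -> (g * b)%g \notin K) ->
    forall t, t \in T -> graph_component S K g (g * t)%g.
  elim: T => [|t T [B IH]]; first by exists [::].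
  have [A At] := near t; exists (A ++ B) => K g gK u.
  rewrite inE => /orP[/eqP ->|uT].
    by apply: At => b bA; apply: gK; rewrite mem_cat bA.
  by apply: IH uT => b bB; apply: gK; rewrite mem_cat bB orbT.
exists (1%g :: B) => K U UK UT g a Ug Ta; move: (Ta) g Ug.
have [T1 TM TV] := generated_subgroup T.
suff : generated T `<=` [set a | generated T a /\
    forall g, U g -> graph_component S K g (g * a)%g].
  by move=> /(_ a Ta)[].
apply: generated_min.
  split=> /=.
  - split=> // g Ug; rewrite mulg1; apply: graph_component_refl.
    by rewrite -[g]mulg1 UK ?inE ?eqxx.
  - move=> b c [Tb Ub] [Tc Uc]; split; first exact: TM.
    move=> g Ug; rewrite mulgA; apply: (@graph_component_trans _ _ _ (g * b)%g).
      exact: Ub.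
    by apply: Uc; apply: UT.
  - move=> b [Tb Ub]; split; first exact: TV.
    move=> g Ug; apply: graph_component_sym; rewrite -{2}[g](mulgVK b).
    by apply: Ub; apply: UT => //; apply: TV.
move=> t tT; split; first exact: generated_mem.
by move=> g Ug; apply: nearB => // b bB; apply: UK; rewrite // inE bB orbT.
Qed.

End CayleyComponents.

Lemma infinite_not_in (T : choiceType) (s : seq T) (A : set T) :
  infinite_set A -> exists2 x, A x & x \notin s.
Proof.
move=> infA; apply: contrapT => AsN; apply: infA.
apply: sub_finite_set (finite_seq s) => x Ax /=.
by apply/negPn/negP => xs; apply: AsN; exists x.
Qed.

Lemma infinite_group (G : groupType) :
  infinitely_many_ends G -> infinite_set [set: G].
Proof.
move=> [[S genS] ends].
have [K [f [inf _]]] := ends S genS 1%N.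
by move=> finG; apply: (inf ord0); apply: sub_finite_set finG.
Qed.

(** Let F be the finite set K B^-1, whose complement consists of the points g for
    which g B misses K. If the first coordinate of g does not occur in F, then all
    points of the fibre over it can be reached from g, and similarly for the second
    coordinate. So all points outside the finite box spanned by the two projections
    of F lie in the component of one base point whose coordinates avoid both
    projections, and every infinite component contains such a point. The
    generating set is arbitrary, so a walk along one factor is not itself a path of
    the Cayley graph; this is why it is thickened by B. *)
Lemma product_one_end (G L : groupType) :
  infinite_set [set: G] -> infinite_set [set: L] ->
  finitely_generated G -> finitely_generated L ->
  number_of_ends (G * L)%type 1.
Proof.
move=> infG infL [sG genG] [sL genL]; split.
  by apply: (fin_gen_cylinder (H := [set: G])); [exists sL | exists sG].
have inG g : generated (map in_left sG) (in_left g : G * L).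
  by apply: (generated_morph in_leftM); rewrite -genG.
have inL l : generated (map in_right sL) (in_right l : G * L).
  by apply: (generated_morph in_rightM); rewrite -genL.
move=> S genS; split.
  exists [::], (fun=> 1%g); split=> [_|i j _]; last by rewrite !ord1.
  (* With no vertex removed, the Cayley graph is connected. *)
  suff -> : graph_component S [::] 1%g = [set: G * L].
    move=> fin; apply: infG; have := finite_image fst fin.
    by apply: sub_finite_set => g _; exists (g, 1%g).
  apply/seteqP; split=> // g _.
  have [B Bgen] := generated_connected S genS.
  have := Bgen [::] setT _ _ 1%g g; rewrite mul1g; apply=> //.
  by rewrite -genS.
have [B1 left_conn] := generated_connected (map in_left sG) genS.
have [B2 right_conn] := generated_connected (map in_right sL) genS.
move=> [K [f [inf sep]]].
pose F := [seq (k * b^-1)%g | k <- K, b <- B1 ++ B2].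
have avoid g b : b \in B1 ++ B2 -> g \notin F -> (g * b)%g \notin K.
  move=> bB; apply: contra => gbK; apply/allpairsP.
  by exists ((g * b)%g, b); split; rewrite //= mulgK.
have genG_snd : generated (map in_left sG) `<=` [set g : G * L | g.2 = 1%g].
  apply: generated_min.
    split=> //= [[a b] [c d] /= -> ->|[a b] /= ->]; first by rewrite mulg1.
    by rewrite invg1.
  by move=> _ /mapP[x _ ->].
have genL_fst : generated (map in_right sL) `<=` [set g : G * L | g.1 = 1%g].
  apply: generated_min.
    split=> //= [[a b] [c d] /= -> ->|[a b] /= ->]; first by rewrite mulg1.
    by rewrite invg1.
  by move=> _ /mapP[x _ ->].
have vertical g l : g.1 \notin map fst F -> graph_component S K g (g.1, l).
  move=> gF; have -> : (g.1, l) = (g * in_right (g.2^-1 * l))%g.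
    by congr pair; rewrite /= ?mulg1 // mulVKg.
  apply: (right_conn K [set g | g.1 \notin map fst F]) => //=.
    move=> h b hF bB; apply: avoid; first by rewrite mem_cat bB orbT.
    by apply: contra hF; apply: map_f.
  by move=> h a hF /genL_fst /= a1; rewrite /= a1 mulg1.
have horizontal g x : g.2 \notin map snd F -> graph_component S K g (x, g.2).
  move=> gF; have -> : (x, g.2) = (g * in_left (g.1^-1 * x))%g.
    by congr pair; rewrite /= ?mulg1 // mulVKg.
  apply: (left_conn K [set g | g.2 \notin map snd F]) => //=.
    move=> h b hF bB; apply: avoid; first by rewrite mem_cat bB.
    by apply: contra hF; apply: map_f.
  by move=> h a hF /genG_snd /= a1; rewrite /= a1 mulg1.
have [x0 _ x0F] := infinite_not_in (map fst F) infG.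
have [l0 _ l0F] := infinite_not_in (map snd F) infL.
have to_base i : graph_component S K (f i) (x0, l0).
  have [g gi] := infinite_not_in
    [seq (x, l) | x <- map fst F, l <- map snd F] (inf i).
  move=> gF; apply: (graph_component_trans gi).
  have [gF1|gF1] := boolP (g.1 \in map fst F); last first.
    apply: (graph_component_trans (vertical g l0 gF1)).
    exact: (horizontal (g.1, l0)).
  have gF2 : g.2 \notin map snd F.
    apply: contra gF => gF2; apply/allpairsP; exists g; split=> //.
    by case: (g).
  apply: (graph_component_trans (horizontal g x0 gF2)).
  exact: (vertical (x0, g.2)).
have /(_ ord0 ord_max) := sep.
suff H : graph_component S K (f ord0) (f ord_max) by move=> /(_ H).
exact: graph_component_trans (to_base _) (graph_component_sym (to_base _)).
Qed.

(** * Fundamental groups and components under a retraction *)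

Lemma continuous_within_comp (S T U : topologicalType) (A : set S) (B : set T)
    (f : T -> U) (q : S -> T) :
  (forall x, A x -> B (q x)) -> {within A, continuous q} ->
  {within B, continuous f} -> {within A, continuous (f \o q)}.
Proof.
move=> AB /subspace_continuousP cq /subspace_continuousP cf.
apply/subspace_continuousP => x Ax W /(cf _ (AB _ Ax)) fW.
apply: (filterS (F := nbhs x)) (cq x Ax _ fW) => y H Ay.
by apply: H => //; apply: AB.
Qed.

Lemma continuous_comp_within (S T U : topologicalType) (A : set S)
    (f : T -> U) (q : S -> T) :
  continuous f -> {within A, continuous q} -> {within A, continuous (f \o q)}.
Proof. by move=> cf; apply: within_continuous_comp => y _; apply: cf. Qed.

Section Retract.
Context {R : realType} {T T' : topologicalType}.
Variables (A : set T) (A' : set T') (p : T' -> T).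
Hypothesis p_cont : continuous p.
Hypothesis (pA : forall y, A' y -> A (p y)).

Lemma loop_in_map (x : T') (f : R -> T') :
  loop_in A' x f -> loop_in A (p x) (p \o f).
Proof.
case=> cf f0 f1 fA; split; rewrite /= ?f0 ?f1 //.
  exact: continuous_comp_within.
by move=> t /fA /pA.
Qed.

Lemma pi1_generated_map x n (l : 'I_n -> R -> T') f :
  pi1_generated A' x l f ->
  pi1_generated A (p x) (fun i => p \o l i) (p \o f).
Proof.
elim=> {f} [i||f g _ IHf _ IHg|f _ IHf|f g _ IHf [F [cF F0 F1 FA]]].
- exact: (pi1_gen _ _ (fun i => p \o l i)).
- exact: pi1_one.
- suff -> : p \o loop_cat f g = loop_cat (p \o f) (p \o g) by apply: pi1_mul.
  by apply/funext => t; rewrite /loop_cat /=; case: ifP.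
- exact: pi1_inv IHf.
- apply: pi1_homotopic IHf _; exists (p \o F); split=> /=.
  + exact: continuous_comp_within.
  + by move=> t /F0[-> ->].
  + by move=> t /F1[-> ->].
  + by move=> a b a01 b01; apply/pA/FA.
Qed.

End Retract.

(** If l generates upstairs, then p l generates downstairs: a loop f is p (s f),
    and an expression of s f in the loops l is mapped by p to one of f. *)
Lemma pi1_finitely_generated_retract (R : realType) (T T' : topologicalType)
    (A : set T) (A' : set T') (p : T' -> T) (s : T -> T') x :
  continuous p -> continuous s -> cancel s p ->
  (forall y, A' y -> A (p y)) -> (forall y, A y -> A' (s y)) ->
  pi1_finitely_generated R A' (s x) -> pi1_finitely_generated R A x.
Proof.
move=> cp cs sK pA sA [n [l [l_in l_gen]]].
exists n, (fun i => p \o l i); split=> [i|f f_in].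
  by rewrite -[x]sK; apply: loop_in_map (l_in i).
have sf := l_gen _ (loop_in_map cs sA f_in).
have := pi1_generated_map cp pA sf; rewrite sK; congr (pi1_generated _ _ _ _).
by apply/funext => t /=; rewrite sK.
Qed.

Lemma connected_component_map (T T' : topologicalType) (f : T -> T')
    (A : set T) (B : set T') x :
  continuous f -> (forall y, A y -> B (f y)) ->
  forall y, connected_component A x y -> connected_component B (f x) (f y).
Proof.
move=> cf AB y [C [Cx CA Cc] Cy]; exists (f @` C); last by exists y.
split; first by exists x.
  by move=> _ [z Cz <-]; apply/AB/CA.
by apply: connected_continuous_connected Cc _; apply: continuous_subspaceT.
Qed.

(** * Collapsing the disc of a commutator onto an interval *)

Section DiscHeight.
Context {R : realType}.
Implicit Types (z : R * R) (t : R).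

(** The height on the disc of [x, t] onto which the disc is collapsed. The boundary
    of the disc reads x, t, x^-1, t^-1 on its four quarters, so the height has to
    be 4 s, 1, 3 - 4 s, 0 at angle 2 pi s. The functions asin (sin) and asin (cos)
    are triangle waves of the angle, a quarter of a period apart, and their
    difference is this trapezoidal wave up to scaling; replacing sine and cosine
    by the Cartesian coordinates extends it to the disc. *)
Definition disc_height z : R := 2^-1 + (asin z.2 - asin z.1) / pi.

(** The extreme values of the difference are only attained on the circle: asin a
    reaching asin b + pi / 2 forces a >= cos (asin b) >= 0, hence
    a ^ 2 >= 1 - b ^ 2. As a consequence the height maps the open disc into the
    open interval, and the collapse maps the open 2-cell into an open edge. *)
Lemma asin_sub_lt (a b : R) : a ^+ 2 + b ^+ 2 < 1 -> asin a - asin b < pi / 2.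
Proof.
move=> ab1.
have bnd (u v : R) : u ^+ 2 + v ^+ 2 < 1 -> -1 <= u <= 1.
  move=> uv1; rewrite -ler_norml -(@ler_pXn2r _ 2) ?nnegrE //.
  rewrite expr1n real_normK ?num_real //.
  by apply: le_trans (ltW uv1); rewrite lerDl sqr_ge0.
have a1 := bnd _ _ ab1; have b1 : -1 <= b <= 1 by apply: (bnd b a); rewrite addrC.
have pi0 := pi_gt0 R.
have [aL aU] := (asin_geNpi2 a1, asin_lepi2 a1).
have [bL bU] := (asin_geNpi2 b1, asin_lepi2 b1).
rewrite ltNge; apply/negP => ab.
have cos_le : cos (asin b) <= a.
  rewrite -[leRHS](@asinK R) ?in_itv //= -sinDpihalf.
  by rewrite leNgt ltr_sin ?in_itv /= -?leNgt; lra.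
have cos_ge0 : 0 <= cos (asin b) by apply: cos_ge0_pihalf; rewrite bL.
have := cos2sin2 (asin b); rewrite asinK ?in_itv //=.
nra.
Qed.

Lemma disc_height_itv z :
  z.1 ^+ 2 + z.2 ^+ 2 < 1 -> 0 < disc_height z < 1.
Proof.
move=> z1; have pi0 := pi_gt0 R; rewrite /disc_height.
have := asin_sub_lt z1.
have := @asin_sub_lt z.2 z.1; rewrite addrC => /(_ z1) h1 h2.
have : - 2^-1 < (asin z.2 - asin z.1) / pi < 2^-1.
  rewrite ltr_pdivlMr // ltr_pdivrMr //; lra.
lra.
Qed.

(** Continuity including the endpoints, which are reached on the boundary of the
    disc: asin is the inverse of a continuous bijection between segments. *)
Lemma continuous_asin_itv : {within `[-1, 1], continuous (@asin R)}.
Proof.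
have pi0 := pi_gt0 R.
have : {within `[sin (- (pi / 2)), sin (pi / 2)], continuous (@asin R)}.
  apply: segment_can_le_continuous; [lra | | exact: sinK].
  exact/continuous_subspaceT/continuous_sin.
by rewrite sinN sin_pihalf.
Qed.

Definition polar (p : R * R) : R * R :=
  (p.1 * cos (2 * pi * p.2), p.1 * sin (2 * pi * p.2)).

Lemma disc_height_polar_continuous :
  {within `[0, 1] `*` `[0, 1], continuous (disc_height \o polar)}.
Proof.
have asin_mul (f : R -> R) : continuous f -> (forall t, -1 <= f t <= 1) ->
    {within `[0, 1] `*` `[0, 1],
       continuous (fun p : R * R => asin (p.1 * f (2 * pi * p.2)))}.
  move=> cf f1; apply: (continuous_within_comp _ _ continuous_asin_itv
    (q := fun p : R * R => p.1 * f (2 * pi * p.2))).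
    move=> [r t] [/=]; rewrite !in_itv /= => /andP[r0 r1] _.
    have := f1 (2 * pi * t); nra.
  apply: continuous_subspaceT => p; apply: cvgM; first exact: cvg_fst.
  apply: (@continuous_comp _ _ _ (fun p : R * R => 2 * pi * p.2) f).
    by apply: cvgM; [exact: cvg_cst | exact: cvg_snd].
  exact: cf.
have csin := asin_mul _ (@continuous_sin R)
  (fun t => introT andP (conj (sin_geN1 t) (sin_le1 t))).
have ccos := asin_mul _ (@continuous_cos R)
  (fun t => introT andP (conj (cos_geN1 t) (cos_le1 t))).
move=> p; apply: cvgD; first exact: cvg_cst.
by apply: cvgM; [apply: cvgB; [exact: csin | exact: ccos] | exact: cvg_cst].
Qed.

Lemma asin_eq (t u : R) : - (pi / 2) <= u <= pi / 2 -> sin u = t -> asin t = u.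
Proof. by move=> u_itv <-; rewrite sinK. Qed.

Lemma disc_height_circle t : 0 <= t <= 1 ->
  disc_height (cos (2 * pi * t), sin (2 * pi * t)) =
  if 4 * t <= 1 then 4 * t else if 4 * t <= 2 then 1
  else if 4 * t <= 3 then 3 - 4 * t else 0.
Proof.
have pi0 := pi_gt0 R; move=> /andP[t0 t1].
have sin_reflect (a : R) : sin (pi - a) = sin a.
  by rewrite sinB sinpi cospi; ring.
have sin_comp (a : R) : sin (pi / 2 - a) = cos a.
  by rewrite sinB sin_pihalf cos_pihalf; ring.
have sin_period (a : R) : sin (a - 2 * pi) = sin a.
  have -> : a - 2 * pi = a - pi - pi by ring.
  by rewrite !(sinB, cosB) sinpi cospi; ring.
have sin_comp_period (a : R) : sin (a - 3 * (pi / 2)) = cos a.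
  have -> : a - 3 * (pi / 2) = a - pi - pi / 2 by field.
  by rewrite sinBpihalf cosB sinpi cospi; ring.
rewrite /disc_height /=; set a := 2 * pi * t.
have aE : 4 * t = 2 * a / pi by rewrite /a; field; lra.
have le_a (c : R) : (4 * t <= c) = (a <= c * (pi / 2)).
  by rewrite aE ler_pdivrMr //; apply/idP/idP => ?; lra.
rewrite !{}le_a aE.
have a0 : 0 <= a by rewrite /a; nra.
have a4 : a <= 2 * pi by rewrite /a; nra.
case: ifPn => [a1|]; last rewrite -ltNge => a1.
  rewrite (@asin_eq (sin a) a) // ?(@asin_eq (cos a) (pi / 2 - a)) //; try lra.
  by field; lra.
case: ifPn => [a2|]; last rewrite -ltNge => a2.
  rewrite (@asin_eq (sin a) (pi - a)) // ?(@asin_eq (cos a) (pi / 2 - a)) //;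
    try lra.
  by field; lra.
case: ifPn => [a3|]; last rewrite -ltNge => a3.
  rewrite (@asin_eq (sin a) (pi - a)) //
    ?(@asin_eq (cos a) (a - 3 * (pi / 2))) //; try lra.
  by field; lra.
rewrite (@asin_eq (sin a) (a - 2 * pi)) //
  ?(@asin_eq (cos a) (a - 3 * (pi / 2))) //; try lra.
by field; lra.
Qed.

Lemma disc_height_polar_itv (p : R * R) :
  (`[0, 1] `*` `[0, 1])%classic p ->
  `[0, 1]%classic ((disc_height \o polar) p).
Proof.
case: p => r t [/=]; rewrite !in_itv /= => r01 t01.
have [r1|r1] := ltP (r ^+ 2) 1.
  have /disc_height_itv : (polar (r, t)).1 ^+ 2 + (polar (r, t)).2 ^+ 2 < 1.
    by rewrite /= !exprMn -mulrDr cos2Dsin2 mulr1.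
  by move=> /andP[/ltW -> /ltW ->].
have {r01 r1} -> : r = 1 by nra.
rewrite /polar !mul1r disc_height_circle //=; case/andP: t01 => t0 t1.
by do ![case: ifPn => ?]; lra.
Qed.

End DiscHeight.

(** * Cells and characteristic maps of the complex of a subgroup *)

Arguments Vertex {R G X rels H gen} _.
Arguments Edge {R G X rels H gen} _ _ _.
Arguments Face {R G X rels H gen} _ _ _.
Arguments Cell0 {G X rels H} _.
Arguments Cell1 {G X rels H} _ _.
Arguments Cell2 {G X rels H} _ _.

Section Complex.
Context {R : realType} {G : groupType} {X : finType}.
Variables (rels : seq (word X)) (H : set G) (gen : X -> G).
Local Notation cayley2 := (@cayley2_complex R G X rels H gen).

Lemma vertex_mulA (v : vertex H) a b :
  vertex_mul (vertex_mul v a) b = vertex_mul v (a * b)%g.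
Proof.
apply/val_inj/seteqP; split=> /= [_ [_ [g vg <-] <-]|_ [g vg <-]].
  by exists g; rewrite ?mulgA.
by exists (g * a)%g; [exists g | rewrite mulgA].
Qed.

Lemma vertex_mul1 (v : vertex H) : vertex_mul v 1%g = v.
Proof.
apply/val_inj/seteqP; split=> /= [_ [g vg <-]|g vg]; first by rewrite mulg1.
by exists g; rewrite ?mulg1.
Qed.

Lemma edge_map_le0 (v : vertex H) x (t : R) :
  t <= 0 -> edge_map rels gen v x t = Vertex v.
Proof.
move=> t0; rewrite /edge_map insubF; first by rewrite t0.
by apply/negbTE; rewrite negb_and -leNgt t0.
Qed.

Lemma edge_map_ge1 (v : vertex H) x (t : R) :
  1 <= t -> edge_map rels gen v x t = Vertex (vertex_mul v (gen x)).
Proof.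
move=> t1; rewrite /edge_map insubF; last first.
  by apply/negbTE; rewrite negb_and -!leNgt t1 orbT.
by rewrite leNgt (lt_le_trans ltr01 t1).
Qed.

(** The universal property of the weak topology. *)
Lemma cayley2_continuous (T : topologicalType) (f : cayley2 -> T) :
  (forall v x, {within `[0, 1], continuous (f \o edge_map rels gen v x)}) ->
  (forall v r, {within `[0, 1] `*` `[0, 1], continuous (f \o face_map gen v r)}) ->
  continuous f.
Proof.
move=> ef ff; apply/continuousP => U oU; split=> [v x|v r].
  by have /continuousP/(_ U oU) := ef v x.
by have /continuousP/(_ U oU) := ff v r.
Qed.

Lemma edge_map_continuous (v : vertex H) x :
  {within `[0, 1], continuous (edge_map rels gen v x : R -> cayley2)}.
Proof. by apply/continuousP => U [oU _]; apply: oU. Qed.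

Lemma face_map_continuous (v : vertex H) r :
  {within `[0, 1] `*` `[0, 1],
    continuous (face_map gen v r : R * R -> cayley2)}.
Proof. by apply/continuousP => U [_ oU]; apply: oU. Qed.

Definition cell_of (y : cayley2) : cell rels H :=
  match y with
  | Vertex v => Cell0 v
  | Edge v x _ => Cell1 v x
  | Face v r _ => Cell2 v r
  end.

Lemma open_cellE c : open_cell c = [set y : cayley2 | cell_of y = c].
Proof.
apply/seteqP; split=> y; case: c => /=.
- by move=> v ->.
- by move=> v x [t _ <-].
- by move=> v r [z _ <-].
- by move=> v; case: y => // u [->].
- by move=> v x; case: y => // u z t [-> ->]; exists t.
- by move=> v r; case: y => // u q z [-> ->]; exists z.
Qed.

End Complex.

(** * The complex of H x Z retracts onto the complex of H *)

Section ProductComplex.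
Context {R : realType} {G : groupType} {X : finType}.
Variables (rels : seq (word X)) (H : set G) (gen : X -> G).

Local Notation Gz := (G * int_grp)%type.
Local Notation Hz := (cylinder H : set Gz).
Local Notation relsz := (prod_rels rels).
Local Notation genz := (prod_gen gen).
Local Notation K := (@cayley2_complex R G X rels H gen).
Local Notation Kz := (@cayley2_complex R Gz (option X) relsz Hz genz).

Lemma rcoset_cylinder g n : rcoset Hz (g, n) = cylinder (rcoset H g).
Proof.
apply/seteqP; split=> [_ [[h m] Hh <-]|[k m] [h Hh /= <-]]; first by exists h.
exists (h, m * n^-1)%g => //; congr pair; exact: mulgVK.
Qed.

Lemma image_fst_cylinder (A : set G) : fst @` (cylinder A : set Gz) = A.
Proof.
by apply/seteqP; split=> [_ [a Aa <-]|a Aa] //; exists (a, 1%g).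
Qed.

Lemma vproj_subproof (v : vertex Hz) : fst @` val v \in range (rcoset H).
Proof.
case: v => A /=; rewrite !inE => -[[g n] _ <-].
by rewrite rcoset_cylinder image_fst_cylinder; exists g.
Qed.

Definition vproj (v : vertex Hz) : vertex H := SigSub (vproj_subproof v).

Lemma vlift_subproof (v : vertex H) :
  (cylinder (val v) : set Gz) \in range (rcoset Hz).
Proof.
case: v => A /=; rewrite !inE => -[g _ <-].
by exists (g, 1%g) => //; apply: rcoset_cylinder.
Qed.

Definition vlift (v : vertex H) : vertex Hz := SigSub (vlift_subproof v).

Lemma vliftK : cancel vlift vproj.
Proof. by move=> v; apply: val_inj; apply: image_fst_cylinder. Qed.

Lemma vprojK : cancel vproj vlift.
Proof.
move=> [A A_in]; apply: val_inj => /=; move: A_in; rewrite inE => -[[g n] _ <-].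
by rewrite rcoset_cylinder image_fst_cylinder.
Qed.

Lemma vlift_mul v (a : Gz) : vlift (vertex_mul v a.1) = vertex_mul (vlift v) a.
Proof.
apply/val_inj/seteqP; split=> [[k m] [g vg /= <-]|_ [[g m] vg <-]].
  by exists (g, m * a.2^-1)%g => //; congr pair; exact: mulgVK.
by exists g.
Qed.

Lemma vproj_mul v (a : Gz) : vproj (vertex_mul v a) = vertex_mul (vproj v) a.1.
Proof. by rewrite -{1}[v]vprojK -vlift_mul vliftK. Qed.

Lemma lift_rel_subproof (r : seq_sub rels) : lift_word (val r) \in relsz.
Proof. by rewrite mem_cat map_f //; apply: valP. Qed.

Definition lift_rel (r : seq_sub rels) : seq_sub relsz :=
  SeqSub (lift_rel_subproof r).

Lemma comm_rel_subproof (x : X) : commutator x \in relsz.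
Proof. by rewrite mem_cat (map_f commutator) ?orbT ?mem_enum. Qed.

Definition comm_rel (x : X) : seq_sub relsz := SeqSub (comm_rel_subproof x).

Definition prod_rel (k : X + seq_sub rels) : seq_sub relsz :=
  match k with inl x => comm_rel x | inr r => lift_rel r end.

(** A relator of the product presentation comes from exactly one generator or
    relator of the original one; the inverse of [prod_rel] serves to distinguish
    the 2-cells [x, t] from the lifted ones. *)
Lemma prod_rel_surj r : {k | prod_rel k = r}.
Proof.
apply: cid; have := valP r.
rewrite mem_cat => /orP[/mapP[w rw rE]|/mapP[x _ rE]].
  by exists (inr (SeqSub rw)); apply: val_inj; rewrite rE.
by exists (inl x); apply: val_inj; rewrite rE.
Qed.

Lemma lift_letter_inj : injective (@lift_letter X).
Proof. by move=> [x b] [y c] [-> ->]. Qed.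

Lemma prod_rel_inj : injective prod_rel.
Proof.
have neq x (r : seq_sub rels) : commutator x <> lift_word (val r).
  by case: (val r) => [|a [|b w]].
move=> [x|r] [y|r'] /(congr1 val) //=; first by case=> ->.
- by move/neq.
- by move/esym/neq.
- by move/(inj_map lift_letter_inj)/val_inj ->.
Qed.

Definition rel_kind (r : seq_sub relsz) : X + seq_sub rels :=
  sval (prod_rel_surj r).

Lemma rel_kindK : cancel rel_kind prod_rel.
Proof. by move=> r; rewrite /rel_kind; case: prod_rel_surj. Qed.

Lemma prod_relK : cancel prod_rel rel_kind.
Proof. by move=> k; apply: prod_rel_inj; rewrite rel_kindK. Qed.

(** The inclusion of the complex of H as the subcomplex without t. *)
Definition base_section (y : K) : Kz :=
  match y with
  | Vertex v => Vertex (vlift v)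
  | Edge v x t => Edge (vlift v) (Some x) t
  | Face v r z => Face (vlift v) (lift_rel r) z
  end.

(** On a 2-cell [x, t] the value is given by [edge_map], whose argument lies in the
    open unit interval by [disc_height_itv]. *)
Definition proj (y : Kz) : K :=
  match y with
  | Vertex v => Vertex (vproj v)
  | Edge v (Some x) t => Edge (vproj v) x t
  | Edge v None _ => Vertex (vproj v)
  | Face v r z =>
      match rel_kind r with
      | inl x => edge_map rels gen (vproj v) x (disc_height (val z))
      | inr r0 => Face (vproj v) r0 z
      end
  end.

Lemma base_sectionK : cancel base_section proj.
Proof.
case=> [v|v x t|v r z] /=; rewrite ?vliftK //.
by rewrite (prod_relK (inr r)).
Qed.

Lemma base_section_edge_map v x (t : R) :
  base_section (edge_map rels gen v x t) = edge_map relsz genz (vlift v) (Some x) t.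
Proof.
rewrite /edge_map; case: insubP => [u _ _ //|_].
by case: ifP => //= _; rewrite -vlift_mul.
Qed.

Lemma base_section_word_path v w (t : R) :
  base_section (word_path rels gen v w t) =
  word_path relsz genz (vlift v) (lift_word w) t.
Proof.
elim: w v t => //= l w IH v t; case: ifP => _; last first.
  by rewrite IH letter_val_lift -vlift_mul.
rewrite /letter_path /=; case: ifP => _; first exact: base_section_edge_map.
by rewrite base_section_edge_map -vlift_mul.
Qed.

Lemma base_section_face_map v r (p : R * R) :
  base_section (face_map gen v r p) = face_map genz (vlift v) (lift_rel r) p.
Proof.
rewrite /face_map; case: insubP => [u _ _ //|_].
by rewrite base_section_word_path size_map.
Qed.

Lemma proj_edge_map v x (t : R) :
  proj (edge_map relsz genz v (Some x) t) = edge_map rels gen (vproj v) x t.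
Proof. by rewrite -{1}[v]vprojK -base_section_edge_map base_sectionK. Qed.

Lemma proj_edge_map_central v (t : R) :
  proj (edge_map relsz genz v None t) = Vertex (vproj v).
Proof.
rewrite /edge_map; case: insubP => [u _ _ //|_].
by case: ifP => //= _; rewrite vproj_mul vertex_mul1.
Qed.

Lemma proj_lift_face_map v r (p : R * R) :
  proj (face_map genz v (lift_rel r) p) = face_map gen (vproj v) r p.
Proof. by rewrite -{1}[v]vprojK -base_section_face_map base_sectionK. Qed.

(** The collapse of the disc agrees with the projection of its attaching path,
    which runs along x, rests while t is read, runs back and rests again. *)
Lemma proj_commutator_path v x (t : R) : 0 <= t <= 1 ->
  proj (word_path relsz genz v (commutator x) (4 * t)) =
  edge_map rels gen (vproj v) x
    (disc_height (cos (2 * pi * t), sin (2 * pi * t))).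
Proof.
move=> t01; rewrite disc_height_circle //= /letter_path /letter_val /=.
case: ifPn => t1; first exact: proj_edge_map.
have -> : (4 * t - 1 <= 1) = (4 * t <= 2) by lra.
case: ifPn => t2.
  by rewrite proj_edge_map_central vproj_mul edge_map_ge1.
have -> : (4 * t - 1 - 1 <= 1) = (4 * t <= 3) by lra.
case: ifPn => t3.
  rewrite proj_edge_map !vproj_mul /= !vertex_mulA mul1g mulgV vertex_mul1.
  by congr edge_map; ring.
have -> : 4 * t - 1 - 1 - 1 <= 1 by lra.
rewrite proj_edge_map_central !vproj_mul /= !vertex_mulA invg1 mulg1 mul1g mulgV.
by rewrite vertex_mul1 edge_map_le0.
Qed.

Lemma proj_commutator_face_map v x (p : R * R) : (`[0, 1] `*` `[0, 1]) p ->
  proj (face_map genz v (comm_rel x) p) =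
  edge_map rels gen (vproj v) x (disc_height (polar p)).
Proof.
case: p => r t [/=]; rewrite !in_itv /= => r01 t01.
rewrite /face_map /=; case: insubP => [z _ zE|].
  by rewrite /= (prod_relK (inl x)) zE.
rewrite -leNgt /= !exprMn -mulrDr cos2Dsin2 mulr1 => r1.
(* Only the boundary circle is left. *)
have {r01 r1} -> : r = 1 by nra.
by rewrite proj_commutator_path // /polar !mul1r.
Qed.

Lemma base_section_continuous : continuous base_section.
Proof.
apply: cayley2_continuous => [v x|v r].
  have -> : base_section \o edge_map rels gen v x =
    edge_map relsz genz (vlift v) (Some x) by apply/funext/base_section_edge_map.
  exact: edge_map_continuous.
have -> : base_section \o face_map gen v r = face_map genz (vlift v) (lift_rel r).
  by apply/funext => p; apply: base_section_face_map.
exact: face_map_continuous.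
Qed.

Lemma proj_continuous : continuous proj.
Proof.
apply: cayley2_continuous => [v [x|]|v r].
- have -> : proj \o edge_map relsz genz v (Some x) =
    edge_map rels gen (vproj v) x by apply/funext/proj_edge_map.
  exact: edge_map_continuous.
- have -> : proj \o edge_map relsz genz v None = cst (Vertex (vproj v)).
    by apply/funext/proj_edge_map_central.
  by apply: continuous_subspaceT; apply: cst_continuous.
rewrite -[r]rel_kindK; case: (rel_kind r) => [x|r0] /=.
  apply: (subspace_eq_continuous
    (f := edge_map rels gen (vproj v) x \o (disc_height \o polar))).
    by move=> p; rewrite inE => /(proj_commutator_face_map v x)/esym.
  exact: (continuous_within_comp disc_height_polar_itv
    disc_height_polar_continuous (@edge_map_continuous _ _ _ _ _ _ _ x)).
have -> : proj \o face_map genz v (lift_rel r0) = face_map gen (vproj v) r0.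
  by apply/funext => p; apply: proj_lift_face_map.
exact: face_map_continuous.
Qed.

(** The cell whose interior contains the projection of the interior of c. *)
Definition cell_proj (c : cell relsz Hz) : cell rels H :=
  match c with
  | Cell0 v => Cell0 (vproj v)
  | Cell1 v (Some x) => Cell1 (vproj v) x
  | Cell1 v None => Cell0 (vproj v)
  | Cell2 v r =>
      match rel_kind r with
      | inl x => Cell1 (vproj v) x
      | inr r0 => Cell2 (vproj v) r0
      end
  end.

Lemma cell_of_proj y : cell_of (proj y) = cell_proj (cell_of y).
Proof.
case: y => [v|v [x|] t|v r z] //=; case: (rel_kind r) => [x|r0] //=.
rewrite /edge_map insubT //=.
by apply: disc_height_itv; apply: (valP z).
Qed.

(** The fibres of [cell_proj]: besides its lift, a vertex is the image of its loop
    t, and an edge x is the image of the 2-cell [x, t]. *)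
Definition cell_lifts (c : cell rels H) : set (cell relsz Hz) :=
  match c with
  | Cell0 v => [set Cell0 (vlift v); Cell1 (vlift v) None]
  | Cell1 v x =>
      [set Cell1 (vlift v) (Some x); Cell2 (vlift v) (comm_rel x)]
  | Cell2 v r => [set Cell2 (vlift v) (lift_rel r)]
  end.

Lemma mem_cell_lifts c : cell_lifts (cell_proj c) c.
Proof.
case: c => [v|v [x|]|v r] /=; rewrite ?vprojK; [by left|by left|by right|].
case rE: (rel_kind r) => [x|r0] /=; rewrite vprojK -[r]rel_kindK rE //.
by right.
Qed.

Lemma finite_cell_proj_preimage (D : set (cell rels H)) :
  finite_set D -> finite_set (cell_proj @^-1` D).
Proof.
move=> finD.
apply: (@sub_finite_set _ _ (\bigcup_(c in D) cell_lifts c)) => [c Dc|].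
  by exists (cell_proj c); last exact: mem_cell_lifts.
apply: bigcup_finite => // -[v|v x|v r] _ /=; last exact: finite_set1.
  exact: finite_set2.
exact: finite_set2.
Qed.

Lemma finite_subcomplex_proj (C : set K) :
  finite_subcomplex C -> finite_subcomplex (proj @^-1` C).
Proof.
move=> [clC [D finD CE]]; split.
  by apply: preimage_closed clC => y _; apply: proj_continuous.
exists (cell_proj @^-1` D); first exact: finite_cell_proj_preimage.
rewrite CE preimage_bigcup; apply/seteqP; split=> y.
  by case=> c Dc; rewrite open_cellE /= cell_of_proj => cE;
    exists (cell_of y); rewrite ?open_cellE //= cE.
case=> c Dc; rewrite open_cellE /= => yc; exists (cell_proj c) => //.
by rewrite open_cellE /= cell_of_proj yc.
Qed.

Lemma tame_from_product :
  tame_in_presentation R relsz Hz genz -> tame_in_presentation R rels H gen.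
Proof.
move=> tameZ C /finite_subcomplex_proj finC x xC.
have := tameZ _ finC (base_section x); rewrite /preimage /= base_sectionK => /(_ xC).
apply: pi1_finitely_generated_retract.
- exact: proj_continuous.
- exact: base_section_continuous.
- exact: base_sectionK.
- move=> y /(connected_component_map proj_continuous (B := ~` C)).
  by rewrite base_sectionK; apply.
- move=> y; apply: (connected_component_map base_section_continuous) => z.
  by rewrite /= base_sectionK.
Qed.

End ProductComplex.

(** * Groups with infinitely many ends *)

Theorem mainTheorem1 (R : realType) :
  (forall G : groupType,
     finitely_presented G -> number_of_ends G 1 -> locally_tame R G) ->
  forall G : groupType,
    finitely_presented G -> infinitely_many_ends G -> locally_tame R G.
Proof.
move=> one_end_tame G _ inf_ends H finH X rels gen pres.
apply: tame_from_product.
apply: (one_end_tame (G * int_grp)%type) (prod_presents pres).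
- by exists (option X), (prod_rels rels), (prod_gen gen); apply: prod_presents.
- apply: product_one_end int_grp_fin_gen.
  + exact: infinite_group.
  + exact: int_grp_infinite.
  + exact: inf_ends.1.
- exact: fin_gen_cylinder int_grp_fin_gen finH.
Qed.
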